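(* Let $\ell_1,\ell_2\in\mathbb{N}\setminus\{1\}$ satisfy $\gcd(\ell_1,\ell_2)=1$, and let $$p(x,y)=q(x,y)\bigl(x^{\ell_1}-y^{\ell_2}\bigr),\qquad q(x,y)\in\{x,y\}.$$ Then, for every $n\ge\max\{\ell_1+1,\ell_2+1\}$, there exists a truncated sequence $\beta^{(2n)}$ having the $k$-extension property relative to $\{1,p,-p\}$ for every $k\in\mathbb{N}_0$, but admitting no $\mathcal{Z}_p$-representing measure.
   Context: Here $\mathbb{N}=\{1,2,\ldots\}$, $\mathbb{N}_0=\mathbb{N}\cup\{0\}$, $\mathcal{P}_m=\{f\in\mathbb{R}[x,y]:\deg f\le m\}$, and $\mathcal{Z}_p=\{(x,y)\in\mathbb{R}^2:p(x,y)=0\}$. A truncated (bivariate) sequence of degree $2n$ is a family of real numbers $\beta\equiv\beta^{(2n)}=\{\beta_{i,j}\}_{i,j\in\mathbb{N}_0,\,i+j\le 2n}$. Its Riesz functional is the linear map $L_\beta:\mathcal{P}_{2n}\to\mathbb{R}$ with $L_\beta(x^iy^j)=\beta_{i,j}$. Let $\mathcal{B}_m$ denote the set of monomials of degree at most $m$. The moment matrix $M(n)\equiv M(n;\beta)$ is the symmetric matrix indexed by $\mathcal{B}_n\times\mathcal{B}_n$ whose entry at monomials $(u,v)$ is $L_\beta(uv)$. For a polynomial $f$ of degree $\delta\le 2n$, the localizing matrix $M_f(n)\equiv M_f(n;\beta)$ is the symmetric matrix indexed by $\mathcal{B}_{n-\lceil\delta/2\rceil}\times\mathcal{B}_{n-\lceil\delta/2\rceil}$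 whose entry at $(u,v)$ is $L_\beta(fuv)$. For $k\in\mathbb{N}_0$, a positive extension of $M(n)$ of order $n+k$ is a moment matrix $M(n+k)\succeq 0$ (of some truncated sequence of degree $2(n+k)$) whose principal submatrix indexed by $\mathcal{B}_n$ equals $M(n)$. The sequence $\beta^{(2n)}$ has the $k$-extension property relative to $\{1,p,-p\}$ if $M(n)$ admits a positive extension $M(n+k)$ such that $M_{p}(n+k)\succeq 0$ and $M_{-p}(n+k)\succeq 0$. A $\mathcal{Z}_p$-representing measure for $\beta^{(2n)}$ is a positive Borel measure $\mu$ on $\mathbb{R}^2$ supported on $\mathcal{Z}_p$ with $\beta_{i,j}=\int x^iy^j\,d\mu$ for all $i+j\le 2n$. *)

(* Defs.v *)
From HB Require Import structures.
From mathcomp Require Import all_boot all_order all_algebra.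
From mathcomp Require Import all_classical all_reals all_analysis.
(* The notations of mpoly are incompatible with those of the analysis library. *)
From mathcomp Require Import -(notations) mpoly.

Set Implicit Arguments.
Unset Strict Implicit.
Unset Printing Implicit Defensive.

Import Order.TTheory GRing.Theory Num.Theory.

Local Open Scope classical_set_scope.
Local Open Scope ring_scope.

Notation bipoly R := (mpoly 2 R).

Definition varx (R : realType) : bipoly R := mpolyX R (mnm1 ord0).
Definition vary (R : realType) : bipoly R := mpolyX R (mnm1 ord_max).

Definition peval (R : realType) (f : bipoly R) (z : R * R) : R :=
  meval (fun i : 'I_2 => if i == ord0 then z.1 else z.2) f.

(* The total degree; [msize f] is the degree plus one, and 0 when f = 0. *)
Definition pdeg (R : realType) (f : bipoly R) : nat := (msize f).-1.

Definition zeroset (R : realType) (f : bipoly R) : set (R * R) :=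
  [set z | peval f z = 0].

(* The pairs (i, j) with i + j <= d, equivalently the monomials x^i y^j of
   degree at most d: i and j are the values of the multi-index at [ord0] and
   at [ord_max]. *)
Notation monoms d := (bmultinom 2 d.+1).

Definition trunc_seq (R : realType) (d : nat) := monoms d -> R.

(* Meaningful on polynomials of degree at most d only: monomials of degree
   greater than d are ignored. *)
Definition riesz (R : realType) (d : nat) (beta : trunc_seq R d)
    (f : bipoly R) : R :=
  \sum_(m : monoms d) mcoeff m f * beta m.

Notation nmonoms n := #|{: monoms n}|.

Definition monom (R : realType) (n : nat) (i : 'I_(nmonoms n)) : bipoly R :=
  mpolyX R (enum_val i : monoms n).

Definition moment_mx (R : realType) (n : nat) (beta : trunc_seq R (2 * n)) :
    'M[R]_(nmonoms n) :=
  \matrix_(i, j) riesz beta (monom R i * monom R j).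

(* [uphalf d] is d / 2 rounded up. The localizing matrix is only used for
   polynomials f of degree at most 2n, so that the subtraction is exact. *)
Definition loc_deg (R : realType) (n : nat) (f : bipoly R) : nat :=
  (n - uphalf (pdeg f))%N.

Definition localizing_mx (R : realType) (n : nat) (beta : trunc_seq R (2 * n))
    (f : bipoly R) : 'M[R]_(nmonoms (loc_deg n f)) :=
  \matrix_(i, j) riesz beta (f * monom R i * monom R j).

Definition psdmx (R : realType) (N : nat) (A : 'M[R]_N) : Prop :=
  A^T = A /\ forall v : 'rV[R]_N, 0 <= (v *m A *m v^T) 0 0.

Lemma monoms_widen_subproof (n k : nat) (m : monoms n) :
  (mdeg m < (n + k).+1)%N.
Proof. by apply: leq_trans (bmdeg m) _; rewrite ltnS leq_addr. Qed.

Definition monoms_widen (n k : nat) (m : monoms n) : monoms (n + k) :=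
  BMultinom (monoms_widen_subproof k m).

Definition index_widen (n k : nat) (i : 'I_(nmonoms n)) :
    'I_(nmonoms (n + k)) :=
  enum_rank (monoms_widen k (enum_val i : monoms n)).

Definition positive_extension (R : realType) (n k : nat)
    (beta : trunc_seq R (2 * n)) (gamma : trunc_seq R (2 * (n + k))) : Prop :=
  psdmx (moment_mx gamma) /\
  mxsub (@index_widen n k) (@index_widen n k) (moment_mx gamma)
    = moment_mx beta.

(* The k-extension property relative to {1, p, -p}. *)
Definition extension_property (R : realType) (n k : nat)
    (beta : trunc_seq R (2 * n)) (p : bipoly R) : Prop :=
  exists gamma : trunc_seq R (2 * (n + k)),
    [/\ positive_extension beta gamma,
        psdmx (localizing_mx gamma p)
      & psdmx (localizing_mx gamma (- p))].

(* R * R carries the product of the Borel sigma-algebras, which is the Borel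
   sigma-algebra of the plane. The zero set of p being closed, mu is supported
   on it exactly when its complement is null. *)
Definition representing_measure (R : realType) (n : nat)
    (beta : trunc_seq R (2 * n)) (p : bipoly R)
    (mu : {measure set (R * R)%type -> \bar R}) : Prop :=
  mu (~` zeroset p) = 0%E /\
  forall m : monoms (2 * n),
    let xy (z : R * R) := (z.1 ^+ m ord0 * z.2 ^+ m ord_max)%:E in
    mu.-integrable setT xy /\ (\int[mu]_z xy z)%E = (beta m)%:E.

(* Main.v *)
Require Import Defs.
From HB Require Import structures.
From mathcomp Require Import all_boot all_order all_algebra.
From mathcomp Require Import all_classical all_reals all_analysis.
From mathcomp Require Import -(notations) mpoly.
From mathcomp Require Import zify ring lra.


(** The sequence lives on the cuspidal curve x^l1 = y^l2 alone, parametrized by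
    x = t^l2, y = t^l1. The monomial x^i y^j becomes t^(l2 i + l1 j), so a
    functional on the coordinate ring of the curve is a sequence s indexed by
    the numerical semigroup S generated by l1 and l2, and it is nonnegative on
    squares when the Hankel form (s_(i+j)) with i and j in S is positive
    semidefinite. The point is that S has gaps. If r is not in S, the entry
    s_(2r) is never on the diagonal of this form, so it may be negative.

    Since l1 and l2 are coprime and larger than 1, one of y, x, xy (according
    to the parities of l1 and l2) has an even weight 2r with r a gap of S
    ([nonneg_nonsquare_monomial]). On the curve this monomial is the square of
    t^r, hence nonnegative, but t^r is not a regular function.

    Take s_k = 3^(k^2), with a minus sign at k = 2r. After rescaling, the (i, j)
    entry of the form has absolute value 3^(-(i-j)^2), so the form is diagonally
    dominant on S whatever the signs off the diagonal are
    ([signed_gauss_psd_nat]). One infinite sequence thus provides positive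
    extensions of all orders. The localizing matrices of p and -p vanish,
    because p is a difference of two monomials of the same weight
    ([localizing_binomial0]).

    A representing measure on the zero set of p could also charge the line
    q = 0. This is excluded because (x^l1 - y^l2)^2 has degree at most 2n and
    its integral is s_(2 l1 l2) - 2 s_(2 l1 l2) + s_(2 l1 l2) = 0. The measure
    is therefore carried by the curve, where the chosen monomial is
    nonnegative, although its integral would be s_(2r) < 0
    ([curve_seq_integral_ge0]). *)

Import Order.TTheory GRing.Theory Num.Theory.

Local Open Scope ring_scope.

(** * A Hankel form that is positive away from a gap *)

(** Up to the sign, these are moments of log-normal type. Their quadratic
    exponent makes the off-diagonal decay of the rescaled Hankel matrix depend
    on i - j only. *)
Definition signed_gauss (R : realType) (r k : nat) : R :=
  (if k == r.*2 then -1 else 1) * 3 ^+ (k ^ 2).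

(** The truncated differences add up to the distance |i - j|. The bound
    1 + 2 (1/3 + 1/9 + ...) = 2 explains the base 3: it leaves exactly the
    diagonal entry to dominate the rest of its row. *)
Lemma sum_geometric_dist_le (R : realType) (N i : nat) :
  \sum_(j < N) 3^-1 ^+ ((i - j) + (j - i)) <= 2 :> R.
Proof.
have u_gt0 k : 0 < 3^-1 ^+ k :> R by rewrite exprn_gt0.
(* The correction term 3^-i makes the bound stable under i -> i + 1. *)
suff bound : 2 * (\sum_(j < N) 3^-1 ^+ ((i - j) + (j - i))) <= 4 - 3^-1 ^+ i :> R.
  by have := u_gt0 i; lra.
elim: i N => [|i IHi] N.
  rewrite expr0.
  suff -> : 2 * (\sum_(j < N) 3^-1 ^+ (0 - j + (j - 0))) = 3 - 3 * 3^-1 ^+ N :> R.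
    by have := u_gt0 N; lra.
  elim: N => [|N IHN]; first by rewrite big_ord0 expr0; lra.
  by rewrite big_ord_recr /= mulrDr IHN sub0n subn0 add0n exprS; field.
case: N => [|N]; first rewrite big_ord0 mulr0 subr_ge0.
  by apply: (@le_trans _ _ 1); [apply: exprn_ile1; lra|lra].
rewrite big_ord_recl /= subn0 sub0n addn0.
under eq_bigr => j _ do rewrite /bump /= add1n !subSS.
by have := IHi N; rewrite exprS; lra.
Qed.

(** Diagonal dominance: with g_i = 3^(2 i^2) v_i, the (i, j) term is
    g_i g_j 3^(-(i-j)^2) up to sign, and the only diagonal term with a minus sign
    is the one at r, where g vanishes. *)
Lemma signed_gauss_psd_nat (R : realType) (r N : nat) (v : nat -> R) :
  v r = 0 ->
  0 <= \sum_(i < N) \sum_(j < N) v i * v j * signed_gauss R r (i + j).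
Proof.
move=> vr0.
pose g i : R := v i * 3 ^+ (2 * i ^ 2).
pose u i j : R := 3^-1 ^+ ((i - j) + (j - i)).
have u_gt0 i j : 0 < u i j by rewrite exprn_gt0.
have uC i j : u i j = u j i by rewrite /u addnC.
have scaleE i j : v i * v j * 3 ^+ ((i + j) ^ 2) =
    g i * g j * 3^-1 ^+ (((i - j) + (j - i)) ^ 2).
  rewrite /g mulrACA -exprD -(mulrA (v i * v j)) exprVn; congr (_ * _).
  have -> : (2 * i ^ 2 + 2 * j ^ 2 =
      (i + j) ^ 2 + (i - j + (j - i)) ^ 2)%N by nia.
  by rewrite exprD mulfK // expf_neq0.
(* The first summand on the left restores the diagonal term g_i^2, so that
   i = j needs no separate treatment when rows are summed. *)
have entry_ge (i j : 'I_N) :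
    (if i == j then 2 * g i ^+ 2 else 0) - (g i ^+ 2 + g j ^+ 2) / 2 * u i j <=
    v i * v j * signed_gauss R r (i + j).
  rewrite /signed_gauss (mulrCA (v i * v j)) scaleE; case: eqVneq => [->|ne_ij].
    rewrite /u !subnn !expr0 addnn (inj_eq double_inj).
    case: eqVneq => [->|_]; last by lra.
    by rewrite /g vr0 mul0r; lra.
  rewrite sub0r.
  have le_sq : 3^-1 ^+ ((i - j + (j - i)) ^ 2) <= u i j.
    by rewrite /u; apply: ler_wiXn2l; [lra|lra|nia].
  set w := 3^-1 ^+ _ in le_sq *.
  have w_ge0 : 0 <= w by rewrite exprn_ge0.
  have gg : 2 * `|g i * g j| <= g i ^+ 2 + g j ^+ 2.
    rewrite normrM -(real_normK (num_real (g i))) -(real_normK (num_real (g j))).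
    by have := sqr_ge0 (`|g i| - `|g j|); nra.
  have : - (`|g i * g j| * w) <= (if (i + j)%N == r.*2 then -1 else 1) * (g i * g j * w).
    rewrite lerNl (le_trans (ler_norm _))// normrN !normrM (ger0_norm w_ge0).
    by case: ifP => _; rewrite ?normrN normr1 mul1r.
  apply: le_trans; rewrite lerN2.
  apply: (le_trans (ler_wpM2l (normr_ge0 _) le_sq)).
  by apply: ler_wpM2r; [exact: ltW|lra].
apply: le_trans (ler_sum _ (fun i _ => ler_sum _ (fun j _ => entry_ge i j))).
have row i : \sum_(j < N) u i j <= 2 := sum_geometric_dist_le R N i.
have -> : \sum_(i < N) \sum_(j < N)
    ((if i == j then 2 * g i ^+ 2 else 0) - (g i ^+ 2 + g j ^+ 2) / 2 * u i j) =
    \sum_(i < N) g i ^+ 2 * (2 - \sum_(j < N) u i j).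
  transitivity (\sum_(i < N) 2 * g i ^+ 2 -
     \sum_(i < N) \sum_(j < N) g i ^+ 2 * u i j).
    have -> : \sum_(i < N) \sum_(j < N) g i ^+ 2 * u i j =
       \sum_(i < N) \sum_(j < N) (g i ^+ 2 + g j ^+ 2) / 2 * u i j.
      transitivity (\sum_(i < N) \sum_(j < N) g i ^+ 2 / 2 * u i j +
          \sum_(i < N) \sum_(j < N) g j ^+ 2 / 2 * u i j).
        rewrite [X in _ = _ + X]exchange_big /= -big_split /=.
        apply: eq_bigr => i _; rewrite -big_split /=; apply: eq_bigr => j _.
        by rewrite (uC j i); lra.
      rewrite -big_split /=; apply: eq_bigr => i _.
      by rewrite -big_split /=; apply: eq_bigr => j _; lra.
    rewrite -sumrB; apply: eq_bigr => i _; rewrite sumrB; congr (_ - _).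
    rewrite (bigD1 i) //= eqxx big1 ?addr0 // => j.
    by rewrite eq_sym => /negPf ->.
  rewrite -sumrB; apply: eq_bigr => i _.
  by rewrite mulrBr mulr_sumr [2 * _]mulrC.
by apply: sumr_ge0 => i _; rewrite mulr_ge0 ?sqr_ge0// subr_ge0.
Qed.

(** Several monomials may have the same weight on the curve, so the form is
    needed for families with repeated weights; grouping equal weights reduces it
    to the previous lemma. *)
Lemma signed_gauss_psd (R : realType) (r : nat) (I : finType) (w : I -> nat)
    (v : I -> R) :
  (forall i, w i != r) ->
  0 <= \sum_i \sum_j v i * v j * signed_gauss R r (w i + w j).
Proof.
move=> w_neq.
pose N := (\max_i w i).+1.
have w_lt i : (w i < N)%N by rewrite ltnS leq_bigmax.
pose wo i := Ordinal (w_lt i).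
pose V k := \sum_(i | w i == k) v i.
have -> : \sum_i \sum_j v i * v j * signed_gauss R r (w i + w j) =
    \sum_(k < N) \sum_(l < N) V k * V l * signed_gauss R r (k + l).
  rewrite (partition_big wo predT) //=; apply: eq_bigr => k _.
  under eq_bigr => i _ do rewrite (partition_big wo predT) //=.
  rewrite exchange_big /=; apply: eq_bigr => l _.
  rewrite /V mulr_suml mulr_suml.
  apply: eq_big => [i|i /eqP <-]; first by [].
  rewrite mulr_sumr mulr_suml.
  by apply: eq_big => [j|j /eqP <-].
apply: signed_gauss_psd_nat.
by rewrite /V big1 // => i /eqP wi; move: (w_neq i); rewrite wi eqxx.
Qed.

(** * The curve functional *)

Lemma riesz_mpolyX (R : realType) (d : nat) (s : multinom 2 -> R)
    (m : multinom 2) :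
  (mdeg m <= d)%N -> riesz (fun b : monoms d => s b) (mpolyX R m) = s m.
Proof.
rewrite -ltnS => lt_md; rewrite /riesz (bigD1 (BMultinom lt_md)) //=.
rewrite mcoeffX eqxx mul1r big1 ?addr0// => b ne_b.
rewrite mcoeffX; case: eqP => [eq_mb|_]; last by rewrite mul0r.
by case/eqP: ne_b; apply: val_inj; rewrite /= eq_mb.
Qed.

Lemma rieszB (R : realType) (d : nat) (beta : trunc_seq R d) (f g : bipoly R) :
  riesz beta (f - g) = riesz beta f - riesz beta g.
Proof.
by rewrite /riesz -sumrB; apply: eq_bigr => m _; rewrite mcoeffB mulrBl.
Qed.

Lemma rieszN (R : realType) (d : nat) (beta : trunc_seq R d) (f : bipoly R) :
  riesz beta (- f) = - riesz beta f.
Proof.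
by rewrite /riesz -sumrN; apply: eq_bigr => m _; rewrite mcoeffN mulNr.
Qed.

Lemma psdmx0 (R : realType) (N : nat) : psdmx (0 : 'M[R]_N).
Proof. by split=> [|v]; rewrite ?trmx0// mulmx0 mul0mx mxE. Qed.

(** The exponent of t in the restriction of a monomial to the curve
    x = t^l2, y = t^l1. *)
Definition curve_weight (l1 l2 : nat) (m : multinom 2) : nat :=
  (l2 * m ord0 + l1 * m ord_max)%N.

Lemma curve_weightD (l1 l2 : nat) (m m' : multinom 2) :
  curve_weight l1 l2 (mnm_add m m') =
  (curve_weight l1 l2 m + curve_weight l1 l2 m')%N.
Proof. by rewrite /curve_weight !mnmDE; lia. Qed.

Definition curve_seq (R : realType) (l1 l2 r d : nat) : trunc_seq R d :=
  fun m => signed_gauss R r (curve_weight l1 l2 m).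

Lemma riesz_curve_seq (R : realType) (l1 l2 r d : nat) (m : multinom 2) :
  (mdeg m <= d)%N ->
  riesz (curve_seq R l1 l2 r d) (mpolyX R m) =
  signed_gauss R r (curve_weight l1 l2 m).
Proof. exact: (@riesz_mpolyX R d (fun m => signed_gauss R r (curve_weight l1 l2 m))). Qed.

Lemma moment_curve_seqE (R : realType) (l1 l2 r N : nat)
    (i j : 'I_(nmonoms N)) :
  moment_mx (curve_seq R l1 l2 r (2 * N)) i j =
  signed_gauss R r (curve_weight l1 l2 (enum_val i : monoms N) +
                    curve_weight l1 l2 (enum_val j : monoms N)).
Proof.
rewrite mxE /monom -mpolyXD riesz_curve_seq ?curve_weightD // mdegD.
have := bmdeg (enum_val i : monoms N); have := bmdeg (enum_val j : monoms N).
lia.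
Qed.

(** The entries are those of the Hankel form at the weights of the monomials,
    and no weight is equal to the gap r. *)
Lemma moment_curve_seq_psd (R : realType) (l1 l2 r N : nat) :
  (forall i j, (l2 * i + l1 * j)%N != r) ->
  psdmx (moment_mx (curve_seq R l1 l2 r (2 * N))).
Proof.
move=> r_gap; split=> [|v].
  by apply/matrixP => i j; rewrite mxE !moment_curve_seqE addnC.
have := @signed_gauss_psd R r _
  (fun i : 'I_(nmonoms N) => curve_weight l1 l2 (enum_val i : monoms N))
  (fun i => v 0 i) (fun i => r_gap _ _).
rewrite exchange_big /=; congr (0 <= _); rewrite mxE; apply: eq_bigr => j _.
rewrite !mxE mulr_suml; apply: eq_bigr => i _.
by rewrite moment_curve_seqE mulrAC.
Qed.

Lemma widen_moment_curve_seq (R : realType) (l1 l2 r n k : nat) :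
  mxsub (@index_widen n k) (@index_widen n k)
    (moment_mx (curve_seq R l1 l2 r (2 * (n + k)))) =
  moment_mx (curve_seq R l1 l2 r (2 * n)).
Proof.
apply/matrixP => i j; rewrite [LHS]mxE !moment_curve_seqE /index_widen.
by rewrite !enum_rankK.
Qed.

(** Two distinct monomials do not cancel; this lower bound on the degree is what
    keeps the products occurring in a localizing matrix within degree 2N. *)
Lemma msupp_binomial (R : realType) (m1 m2 : multinom 2) :
  m1 != m2 -> (mdeg m1 <= pdeg (mpolyX R m1 - mpolyX R m2)%R)%N.
Proof.
move=> ne12; rewrite /pdeg.
have: m1 \in msupp (mpolyX R m1 - mpolyX R m2).
  by rewrite mcoeff_msupp mcoeffB !mcoeffX eqxx (eq_sym m2) (negbTE ne12) subr0 oner_neq0.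
by move/msize_mdeg_lt; case: (msize _).
Qed.

(** A binomial with equal weights restricts to 0 on the curve, and so do its
    multiples. *)
Lemma localizing_binomial0 (R : realType) (l1 l2 r N : nat)
    (m1 m2 : multinom 2) :
  m1 != m2 -> curve_weight l1 l2 m1 = curve_weight l1 l2 m2 ->
  (mdeg m1 <= 2 * N)%N -> (mdeg m2 <= 2 * N)%N ->
  let p := mpolyX R m1 - mpolyX R m2 in
  localizing_mx (curve_seq R l1 l2 r (2 * N)) p = 0 /\
  localizing_mx (curve_seq R l1 l2 r (2 * N)) (- p) = 0.
Proof.
move=> ne12 eq_w le1 le2 p.
have deg1 : (mdeg m1 <= pdeg p)%N by exact: msupp_binomial.
have deg2 : (mdeg m2 <= pdeg p)%N.
  rewrite /p -opprB /pdeg msizeN; apply: msupp_binomial; by rewrite eq_sym.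
have locN : loc_deg N (- p) = (N - uphalf (pdeg p))%N.
  by rewrite /loc_deg /pdeg msizeN.
have vanish (a b : multinom 2) :
    (mdeg a <= N - uphalf (pdeg p))%N -> (mdeg b <= N - uphalf (pdeg p))%N ->
    riesz (curve_seq R l1 l2 r (2 * N)) (p * mpolyX R a * mpolyX R b) = 0.
  move=> da db; rewrite /p !mulrBl -!mpolyXD rieszB.
  by rewrite !riesz_curve_seq ?mdegD ?curve_weightD ?eq_w ?subrr; [| lia | lia].
split; apply/matrixP => i j; rewrite !mxE ?mulNr ?rieszN /monom.
  by apply: vanish; rewrite -ltnS; apply: bmdeg.
by rewrite vanish ?oppr0 // -locN -ltnS; apply: bmdeg.
Qed.

(** * Obstruction to a representing measure *)

(** A nonnegative function with zero integral vanishes almost everywhere, so that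
    h agrees almost everywhere with its absolute value. *)
Lemma integral_ge0_on_zeros (d : measure_display) (T : measurableType d)
    (R : realType) (mu : {measure set T -> \bar R}) (f h : T -> R) :
  mu.-integrable setT (EFin \o f) -> mu.-integrable setT (EFin \o h) ->
  (forall z, 0 <= f z) -> (\int[mu]_z (f z)%:E)%E = 0%E ->
  (forall z, f z = 0 -> 0 <= h z) ->
  (0 <= \int[mu]_z (h z)%:E)%E.
Proof.
move=> if_ ih f_ge0 intf h_ge0.
have mf := measurable_int mu if_; have mh := measurable_int mu ih.
have f_ae0 : ae_eq mu setT (EFin \o f) (cst 0%E).
  apply/(ae_eq_integral_abs mu measurableT mf); rewrite -[RHS]intf.
  by apply: eq_integral => z _; rewrite /= ger0_norm.
rewrite (@ae_eq_integral _ _ _ mu _ (abse \o (EFin \o h))) //.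
- by apply: integral_ge0 => z _; rewrite /= lee_fin.
- exact: (measurable_int mu (integrable_abse ih)).
- apply: filterS f_ae0 => z /(_ I) [fz0] _ /=.
  by rewrite ger0_norm // h_ge0.
Qed.

(** The three moments in the expansion of (x^l1 - y^l2)^2 have the same weight
    2 l1 l2 and cancel, which forces the measure onto the curve. *)
Lemma curve_seq_integral_ge0 {R : realType} {l1 l2 r n e1 e2 : nat}
    {p : bipoly R} {mu : {measure set (R * R)%type -> \bar R}} :
  (l1 <= n)%N -> (l2 <= n)%N -> (e1 + e2 <= 2 * n)%N ->
  (forall x y : R, x ^+ l1 = y ^+ l2 -> 0 <= x ^+ e1 * y ^+ e2) ->
  representing_measure (curve_seq R l1 l2 r (2 * n)) p mu ->
  0 <= signed_gauss R r (l2 * e1 + l1 * e2).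
Proof.
move=> le1 le2 le_e e_ge0 [_ mom].
have momE i j : (i + j <= 2 * n)%N ->
    mu.-integrable setT (EFin \o (fun z : R * R => z.1 ^+ i * z.2 ^+ j)) /\
    (\int[mu]_z (z.1 ^+ i * z.2 ^+ j)%:E)%E =
      (signed_gauss R r (l2 * i + l1 * j))%:E.
  move=> le_ij.
  pose m := mnm_add (mnm_muln (mnm1 ord0) i) (mnm_muln (mnm1 ord_max) j) : multinom 2.
  have m_lt : (mdeg m < (2 * n).+1)%N by rewrite mdegD !mdegMn !mdeg1 !mul1n ltnS.
  have [m0 m1] : m ord0 = i /\ m ord_max = j.
    by rewrite /m !mnmDE !mulmnE !mnm1E /=; lia.
  have /= := mom (BMultinom m_lt).
  by rewrite /curve_seq /curve_weight /= m0 m1.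
have [i20 E20] := momE l1.*2 0%N ltac:(lia).
have [i11 E11] := momE l1 l2 ltac:(lia).
have [i02 E02] := momE 0%N l2.*2 ltac:(lia).
have [ie Ee] := momE e1 e2 le_e.
pose f (z : R * R) : R :=
  (z.1 ^+ l1.*2 * z.2 ^+ 0 - z.1 ^+ l1 * z.2 ^+ l2) +
  (z.1 ^+ 0 * z.2 ^+ l2.*2 - z.1 ^+ l1 * z.2 ^+ l2).
have fE z : f z = (z.1 ^+ l1 - z.2 ^+ l2) ^+ 2.
  by rewrite /f !expr0 -!addnn !exprD; ring.
have [if_ intf] : mu.-integrable setT (EFin \o f) /\
    (\int[mu]_z (f z)%:E)%E = 0%E.
  have iA := integrableB measurableT i20 i11.
  have iB := integrableB measurableT i02 i11.
  split; first exact: (integrableD measurableT iA iB).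
  rewrite (integralD measurableT iA iB) /=.
  rewrite !integralB_EFin // E20 E11 E02 -!EFinB -EFinD; congr EFin.
  have -> : (l2 * l1.*2 + l1 * 0 = (l2 * l1).*2)%N by lia.
  have -> : (l2 * 0 + l1 * l2.*2 = (l2 * l1).*2)%N by lia.
  have -> : (l2 * l1 + l1 * l2 = (l2 * l1).*2)%N by lia.
  by rewrite subrr addr0.
rewrite -lee_fin -Ee.
apply: (@integral_ge0_on_zeros _ _ _ mu f _ if_ ie) => //.
- by move=> z; rewrite fE sqr_ge0.
- move=> z; rewrite fE => /eqP; rewrite sqrf_eq0 subr_eq0 => /eqP.
  exact: e_ge0.
Qed.

(** * The choice of the monomial *)

(** The monomial is xy if l1 and l2 are odd, x if l2 is even, and y if l1 is
    even. If half of its weight were in the semigroup, a size comparison would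
    leave an equation making l1 divide l2 or l2 divide l1. *)
Lemma nonneg_nonsquare_monomial (R : realType) (l1 l2 : nat) :
  (1 < l1)%N -> (1 < l2)%N -> coprime l1 l2 ->
  exists e1 e2 r : nat,
    [/\ (e1 + e2 <= 2)%N, (l2 * e1 + l1 * e2)%N = r.*2,
        forall i j, (l2 * i + l1 * j)%N != r
      & forall x y : R, x ^+ l1 = y ^+ l2 -> 0 <= x ^+ e1 * y ^+ e2].
Proof.
move=> l1_gt1 l2_gt1 co.
have ndiv a b : (1 < a)%N -> coprime a b -> ~ (a %| b)%N.
  move=> a_gt1 co_ab dv; move: co_ab.
  by rewrite /coprime; move/gcdn_idPl: dv => -> /eqP; lia.
have n12 := ndiv _ _ l1_gt1 co.
have n21 : ~ (l2 %| l1)%N by apply: ndiv; rewrite // coprime_sym.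
have [odd1|even1] := boolP (odd l1); have [odd2|even2] := boolP (odd l2).
- exists 1%N, 1%N, (l1 + l2)./2; split=> //.
  + by rewrite !muln1 even_halfK ?oddD ?odd1 ?odd2 // addnC.
  + move=> i j; apply/eqP => E.
    have {}E : (2 * (l2 * i) + 2 * (l1 * j) = l1 + l2)%N.
      by rewrite -mulnDr E mul2n even_halfK ?oddD ?odd1 ?odd2.
    case: i E => [|i] E.
      apply: n12; apply/dvdnP; exists (2 * j - 1)%N; nia.
    case: j E => [|j] E; last by nia.
    apply: n21; apply/dvdnP; exists (2 * i.+1 - 1)%N; nia.
  + move=> x y xy; rewrite -(exprn_odd_ge0 _ odd1) !expr1 exprMn xy -exprD.
    by rewrite exprn_even_ge0 // oddD odd1 odd2.
- exists 1%N, 0%N, l2./2; split=> //.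
  + by rewrite muln1 muln0 addn0 even_halfK.
  + move=> i j; apply/eqP => E.
    have {}E : (2 * (l2 * i) + 2 * (l1 * j) = l2)%N.
      by rewrite -mulnDr E mul2n even_halfK.
    have i0 : i = 0%N by nia.
    by apply: n12; apply/dvdnP; exists (2 * j)%N; rewrite -E i0; nia.
  + move=> x y xy; rewrite expr1 expr0 mulr1 -(exprn_odd_ge0 _ odd1) xy.
    exact: exprn_even_ge0.
- exists 0%N, 1%N, l1./2; split=> //.
  + by rewrite muln1 muln0 add0n even_halfK.
  + move=> i j; apply/eqP => E.
    have {}E : (2 * (l2 * i) + 2 * (l1 * j) = l1)%N.
      by rewrite -mulnDr E mul2n even_halfK.
    have j0 : j = 0%N by nia.
    by apply: n21; apply/dvdnP; exists (2 * i)%N; rewrite -E j0; nia.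
  + move=> x y xy; rewrite expr1 expr0 mul1r -(exprn_odd_ge0 _ odd2) -xy.
    exact: exprn_even_ge0.
- have : (2 %| gcdn l1 l2)%N by rewrite dvdn_gcd !dvdn2 even1 even2.
  by rewrite (eqP co).
Qed.

Theorem theorem3p5 (R : realType) (l1 l2 : nat) (hl1 : (1 < l1)%N)
    (hl2 : (1 < l2)%N) (hl : coprime l1 l2) (q : bipoly R)
    (hq : q = varx R \/ q = vary R) (n : nat)
    (hn : (maxn l1.+1 l2.+1 <= n)%N) :
  let p := q * (varx R ^+ l1 - vary R ^+ l2) in
  exists beta : trunc_seq R (2 * n),
    (forall k : nat, extension_property k beta p) /\
    ~ (exists mu : {measure set (R * R)%type -> \bar R},
        representing_measure beta p mu).
Proof.
move=> p.
have [e1 [e2 [r [le_e w_e r_gap e_ge0]]]] :=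
  @nonneg_nonsquare_monomial R l1 l2 hl1 hl2 hl.
exists (curve_seq R l1 l2 r (2 * n)); split=> [k|[mu repr_mu]].
  exists (curve_seq R l1 l2 r (2 * (n + k))).
  have [c qE] : exists c : 'I_2, q = mpolyX R (mnm1 c).
    by case: hq => ->; [exists ord0|exists ord_max].
  pose m1 := mnm_add (mnm1 c) (mnm_muln (mnm1 ord0) l1).
  pose m2 := mnm_add (mnm1 c) (mnm_muln (mnm1 (ord_max : 'I_2)) l2).
  have pE : p = mpolyX R m1 - mpolyX R m2.
    by rewrite /p qE /varx /vary !mpolyXn mulrBr -!mpolyXD.
  have d1 : mdeg m1 = l1.+1 by rewrite mdegD mdegMn !mdeg1 mul1n.
  have d2 : mdeg m2 = l2.+1 by rewrite mdegD mdegMn !mdeg1 mul1n.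
  have [|||| Lp LNp] := @localizing_binomial0 R l1 l2 r (n + k) m1 m2.
  - apply/eqP => /(congr1 (fun m : multinom 2 => m ord0)).
    by rewrite !mnmDE !mulmnE !mnm1E /=; lia.
  - by rewrite !curve_weightD /curve_weight !mulmnE !mnm1E /=; lia.
  - by rewrite d1; lia.
  - by rewrite d2; lia.
  rewrite pE Lp LNp; split; try exact: psdmx0.
  by split; [exact: moment_curve_seq_psd|exact: widen_moment_curve_seq].
have le_l1 : (l1 <= n)%N by lia.
have le_l2 : (l2 <= n)%N by lia.
have le_en : (e1 + e2 <= 2 * n)%N by lia.
have := curve_seq_integral_ge0 le_l1 le_l2 le_en e_ge0 repr_mu.
by rewrite w_e /signed_gauss eqxx mulN1r oppr_ge0 leNgt exprn_gt0.
Qed.
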